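(* Every $q$-finite purely inseparable extension $K/k$ is a finite composite of $w_0$-generated extensions: there exist an integer $n$ and a finite chain of intermediate fields $k=K_0\subseteq K_1\subseteq\cdots\subseteq K_n=K$ such that $K_{i+1}/K_i$ is $w_0$-generated for every $i\in\{0,\dots,n-1\}$.
   Context: All fields have characteristic $p>0$ and all extensions are purely inseparable subextensions of a fixed algebraic closure $\Omega$ of $k$. $K/k$ is of finite (bounded) exponent if $K^{p^e}\subseteq k$ for some $e\in\mathbf N$; otherwise it is of unbounded exponent. An $r$-basis of $K/k$ is a subset $B\subseteq K$ with $K=k(K^p)(B)$ and $x\notin k(K^p)(B\setminus\{x\})$ for all $x\in B$; all $r$-bases have the same cardinality. If $K/k$ has finite exponent, $di(K/k)$ denotes the cardinality of an $r$-basis (equivalently of a minimal generating set). In general $di(K/k)=\sup_{n\ge 1} di\big((k^{p^{-n}}\cap K)/k\big)$, where $k^{p^{-n}}=\{a\in\Omega : a^{p^n}\in k\}$. $K/k$ is $q$-finite if $di(K/k)$ is finite. $K/k$ is $w_0$-generated if it has no proper subextension $L/k$ ($k\subseteq L\subsetneq K$) of unbounded exponent. *)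

(* Defs.v *)
From mathcomp Require Import all_boot all_algebra.
From mathcomp Require Import all_classical.
Set Implicit Arguments.
Unset Strict Implicit.
Unset Printing Implicit Defensive.
Import GRing.Theory.
Local Open Scope classical_set_scope.
Local Open Scope ring_scope.

(* All fields are subfields of a fixed algebraically closed field, represented
   as sets of its elements. *)
Definition subfield (Omega : fieldType) (L : set Omega) : Prop :=
  GRing.divring_closed (mem L).

Definition extension (Omega : fieldType) (k K : set Omega) : Prop :=
  [/\ subfield k, subfield K & k `<=` K].

Definition algebraic_closure_of (Omega : closedFieldType) (k : set Omega)
    : Prop :=
  subfield k /\
  forall x : Omega,
    exists q : {poly Omega}, [/\ q != 0, q \is a polyOver (mem k) & root q x].

Definition purely_inseparable_ext (p : nat) (Omega : fieldType)
    (k K : set Omega) : Prop :=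
  extension k K /\ forall x, K x -> exists n : nat, k (x ^+ (p ^ n)).

Definition finite_exponent (p : nat) (Omega : fieldType) (k K : set Omega)
    : Prop :=
  exists e : nat, [set x ^+ (p ^ e) | x in K] `<=` k.

Definition adjoin (Omega : fieldType) (k S : set Omega) : set Omega :=
  smallest (@subfield Omega) (k `|` S).

Definition r_basis (p : nat) (Omega : fieldType) (k K B : set Omega) : Prop :=
  let k_Kp := adjoin k [set x ^+ p | x in K] in
  [/\ B `<=` K,
      K = adjoin k_Kp B
    & forall x, B x -> ~ adjoin k_Kp (B `\ x) x].

(* k^{p^{-n}} *)
Definition root_field (p : nat) (Omega : fieldType) (k : set Omega) (n : nat)
    : set Omega :=
  [set a | k (a ^+ (p ^ n))].

(* For K/k of finite exponent: di(K/k) = d, where d is finite.  Since all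
   r-bases have the same cardinality, it is enough to exhibit one. *)
Definition is_di_finite_exponent (p : nat) (Omega : fieldType)
    (k K : set Omega) (d : nat) : Prop :=
  exists2 B : set Omega, r_basis p k K B & (B #= `I_d)%card.

(* d is an upper bound of the cardinals di((k^{p^{-n}} \cap K)/k), n >= 1. *)
Definition di_upper_bound (p : nat) (Omega : fieldType) (k K : set Omega)
    (d : nat) : Prop :=
  forall n : nat, (1 <= n)%N ->
    exists2 m : nat,
      is_di_finite_exponent p k (root_field p k n `&` K) m & (m <= d)%N.

(* In general: di(K/k), a supremum of cardinals, is the finite cardinal d. *)
Definition is_di (p : nat) (Omega : fieldType) (k K : set Omega) (d : nat)
    : Prop :=
  di_upper_bound p k K d /\
  forall d' : nat, di_upper_bound p k K d' -> (d <= d')%N.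

Definition q_finite (p : nat) (Omega : fieldType) (k K : set Omega) : Prop :=
  exists d : nat, is_di p k K d.

(* No unboundedness is required of K/k itself, so every extension of finite
   exponent is w_0-generated. *)
Definition w0_generated (p : nat) (Omega : fieldType) (k K : set Omega)
    : Prop :=
  ~ exists L : set Omega,
      [/\ extension k L, L `<` K & ~ finite_exponent p k L].

(* Main.v *)
(* Let M = k(K^{p^e}) with e large. As di(K/k) is finite, M = k(M^p), i.e. M/k
   is relatively perfect, and K/M has exponent at most e, so K/M is
   w_0-generated. If L < M are relatively perfect over k and M/L is not
   w_0-generated, it has a proper subextension N/L of unbounded exponent, and
   P = L(N^{p^f}) with f large is relatively perfect over k and strictly between
   L and M. Since di over k strictly increases along relatively perfect
   extensions of k, this refinement of k <= M stops. *)
From HB Require Import structures.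
Require Import Defs.
From mathcomp Require Import all_boot all_algebra.
From mathcomp Require Import all_classical.
Set Implicit Arguments.
Unset Strict Implicit.
Unset Printing Implicit Defensive.
Import GRing.Theory.
Local Open Scope classical_set_scope.
Local Open Scope ring_scope.

(** The proof [FS] is an index of the predicate so that the closure structure below can be attached
    to it; the [rpred] and [polyOver] lemmas then apply to a mere set [F]. *)
Definition in_subfield (Omega : fieldType) (F : set Omega) (FS : subfield F) :
  {pred Omega} := mem F.

HB.instance Definition _ (Omega : fieldType) (F : set Omega)
    (FS : subfield F) :=
  GRing.isDivringClosed.Build Omega (in_subfield FS) FS.

(** * Subfields and adjunction *)

Section Subfields.
Variable Omega : fieldType.
Implicit Types (F G L S T : set Omega) (x y z : Omega) (s t : seq Omega).

Lemma in_subfieldE F (FS : subfield F) x : (x \in in_subfield FS) = (x \in F).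
Proof. by []. Qed.

Lemma subfieldP F :
  F 1 -> (forall x y, F x -> F y -> F (x - y)) ->
  (forall x y, F x -> F y -> F (x / y)) -> subfield F.
Proof.
move=> F1 FB Fdiv; split; first by rewrite inE.
  by move=> x y; rewrite !inE; exact: FB.
by move=> x y; rewrite !inE; exact: Fdiv.
Qed.

Lemma subfield0 F : subfield F -> F 0.
Proof. by move=> FS; apply: set_mem; apply: (rpred0 (in_subfield FS)). Qed.

Lemma subfield1 F : subfield F -> F 1.
Proof. by move=> FS; apply: set_mem; apply: (rpred1 (in_subfield FS)). Qed.

Lemma subfieldB F x y : subfield F -> F x -> F y -> F (x - y).
Proof.
by move=> FS /mem_set Fx /mem_set Fy; apply: set_mem;
   apply: (@rpredB _ (in_subfield FS)).
Qed.

Lemma subfieldM F x y : subfield F -> F x -> F y -> F (x * y).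
Proof.
by move=> FS /mem_set Fx /mem_set Fy; apply: set_mem;
   apply: (@rpredM _ (in_subfield FS)).
Qed.

Lemma subfield_div F x y : subfield F -> F x -> F y -> F (x / y).
Proof.
by move=> FS /mem_set Fx /mem_set Fy; apply: set_mem;
   apply: (@rpred_div _ (in_subfield FS)).
Qed.

Lemma subfieldX F x n : subfield F -> F x -> F (x ^+ n).
Proof.
by move=> FS /mem_set Fx; apply: set_mem; apply: (@rpredX _ (in_subfield FS)).
Qed.

Lemma adjoin_subfield F S : subfield (adjoin F S).
Proof.
apply: subfieldP => [M [MS _]|x y Fx Fy M MS|x y Fx Fy M MS].
- exact: subfield1.
- by apply: (subfieldB MS.1); [apply: Fx|apply: Fy].
- by apply: (subfield_div MS.1); [apply: Fx|apply: Fy].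
Qed.

Lemma sub_adjoin_base F S : F `<=` adjoin F S.
Proof. by move=> x Fx M [_ FM]; apply: FM; left. Qed.

Lemma sub_adjoin_gen F S : S `<=` adjoin F S.
Proof. by move=> x Fx M [_ FM]; apply: FM; right. Qed.

Lemma adjoin_sub F S L :
  subfield L -> F `<=` L -> S `<=` L -> adjoin F S `<=` L.
Proof. by move=> LS FL SL x; apply; split=> // z [/FL|/SL]. Qed.

Lemma adjoinS F G S T : F `<=` G -> S `<=` T -> adjoin F S `<=` adjoin G T.
Proof.
move=> FG ST; apply: adjoin_sub; first exact: adjoin_subfield.
  exact: subset_trans FG (@sub_adjoin_base G T).
exact: subset_trans ST (@sub_adjoin_gen G T).
Qed.

Lemma adjoin_id F S : subfield F -> S `<=` F -> adjoin F S = F.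
Proof.
move=> FS SF; apply/seteqP; split; last exact: sub_adjoin_base.
exact: adjoin_sub.
Qed.

Lemma adjoin_adjoin F S T : adjoin (adjoin F S) T = adjoin F (S `|` T).
Proof.
apply/seteqP; split; apply: adjoin_sub; try exact: adjoin_subfield.
- by apply: adjoinS => // x; left.
- by move=> x Tx; apply: sub_adjoin_gen; right.
- by move=> x Fx; apply: sub_adjoin_base; apply: sub_adjoin_base.
- move=> x [Sx|Tx]; last exact: sub_adjoin_gen.
  by apply: sub_adjoin_base; apply: sub_adjoin_gen.
Qed.

(** The elements that need only finitely many generators form a subfield containing [F] and [S]: two
    lists are merged by concatenation. *)
Lemma adjoin_finitary F S x : adjoin F S x ->
  exists2 s : seq Omega, [set` s] `<=` S & adjoin F [set` s] x.
Proof.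
pose U := [set x | exists2 s : seq Omega, [set` s] `<=` S
                                        & adjoin F [set` s] x].
have op2 (f : Omega -> Omega -> Omega) :
    (forall L y z, subfield L -> L y -> L z -> L (f y z)) ->
    forall y z, U y -> U z -> U (f y z).
  move=> fL y z [s sS sy] [t tS tz]; exists (s ++ t).
    by move=> u /=; rewrite mem_cat => /orP[/sS|/tS].
  apply: (fL (adjoin F [set` s ++ t])); first exact: adjoin_subfield.
    by apply: adjoinS sy => // u /= us; rewrite mem_cat us.
  by apply: adjoinS tz => // u /= us; rewrite mem_cat us orbT.
apply: (@adjoin_sub _ _ U).
- apply: subfieldP.
  + by exists [::] => //; apply: subfield1; apply: adjoin_subfield.
  + by apply: (op2 (fun y z => y - z)) => L y z; apply: subfieldB.
  + by apply: (op2 (fun y z => y / z)) => L y z; apply: subfield_div.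
- by move=> y Fy; exists [::] => //; exact: sub_adjoin_base.
- move=> y Sy; exists [:: y]; first by move=> z /=; rewrite inE => /eqP ->.
  by apply: sub_adjoin_gen; rewrite /= inE.
Qed.

Lemma adjoin_seq_finitary F S t : [set` t] `<=` adjoin F S ->
  exists2 s : seq Omega, [set` s] `<=` S & [set` t] `<=` adjoin F [set` s].
Proof.
elim: t => [|x t IHt] tF; first by exists [::].
have [s sS st] : exists2 s : seq Omega, [set` s] `<=` S
    & [set` t] `<=` adjoin F [set` s].
  by apply: IHt => y /= yt; apply: tF; rewrite /= inE yt orbT.
have [|s' s'S s'x] := @adjoin_finitary F S x.
  by apply: tF; rewrite /= inE eqxx.
exists (s' ++ s) => [y /=|y /=].
  by rewrite mem_cat => /orP[/s'S|/sS].
rewrite inE => /orP[/eqP ->|/st].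
  by apply: adjoinS s'x => // u /= us; rewrite mem_cat us.
by apply: adjoinS => // u /= us; rewrite mem_cat us orbT.
Qed.

Lemma set_cons x s : [set` x :: s] = [set x] `|` [set` s].
Proof.
apply/seteqP; split=> y /=; rewrite inE.
  by case/orP=> [/eqP ->|]; [left|right].
by case=> [->|->]; rewrite ?eqxx ?orbT.
Qed.

Lemma set_cat s t : [set` s ++ t] = [set` s] `|` [set` t].
Proof.
apply/seteqP; split=> y /=; rewrite mem_cat.
  by case/orP; [left|right].
by case=> [->|->]; rewrite ?orbT.
Qed.

Lemma adjoin_cons F x s :
  adjoin F [set` x :: s] = adjoin (adjoin F [set x]) [set` s].
Proof. by rewrite adjoin_adjoin set_cons. Qed.

Lemma adjoin_nil F : subfield F -> adjoin F [set` [::]] = F.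
Proof. by move=> FS; apply: adjoin_id. Qed.

End Subfields.

(** * Adjunction of a single p-th root *)

Section PurelyInseparable.
Variables (p : nat) (Omega : fieldType).
Hypothesis charp : p \in [pchar Omega].
Implicit Types (F G L S T : set Omega) (x y z : Omega) (s t : seq Omega).

Let p_pr : prime p. Proof. exact: pcharf_prime charp. Qed.

Lemma exprB_pchar x y e :
  (x - y) ^+ (p ^ e) = x ^+ (p ^ e) - y ^+ (p ^ e).
Proof.
have pe : [pchar Omega].-nat (p ^ e)%N by rewrite pnatX pnatE // charp.
by rewrite exprDn_pchar // exprNn_pchar.
Qed.

Lemma root_field_subfield F e : subfield F -> subfield (root_field p F e).
Proof.
move=> FS; apply: subfieldP => [|x y|x y]; rewrite /root_field /=.
- by rewrite expr1n; apply: subfield1.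
- by rewrite exprB_pchar; apply: subfieldB.
- by rewrite expr_div_n; apply: subfield_div.
Qed.

(** Each round subtracts the multiple of [g] that cancels the leading term of [f]; this multiple has
    coefficients in [F], hence so has the remainder. *)
Lemma polyOver_division F (FS : subfield F) (f g : {poly Omega}) :
  g != 0 -> f \is a polyOver (in_subfield FS) ->
  g \is a polyOver (in_subfield FS) ->
  exists u v : {poly Omega}, [/\ v \is a polyOver (in_subfield FS),
    f = u * g + v & (size v < size g)%N].
Proof.
move=> g0 + Fg.
have [n] := ubnP (size f); elim: n f => // n IHn f; rewrite ltnS => fn Ff.
have [fg|gf] := ltnP (size f) (size g).
  by exists 0, f; rewrite mul0r add0r.
have f0 : f != 0.
  apply: contraNneq g0 => f0.
  by rewrite -size_poly_leq0 -[0%N](@size_poly0 Omega) -f0.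
pose c := lead_coef f / lead_coef g.
have Fc : c \in in_subfield FS.
  by rewrite rpred_div // lead_coefE; apply/polyOverP.
pose h := c *: 'X^(size f - size g) * g.
have Fh : h \is a polyOver (in_subfield FS).
  by rewrite rpredM // polyOverZ // polyOverXn.
have [||u [v [Fv E vg]]] := IHn (f - h).
- apply: leq_trans fn.
  have sh : size h = size f.
    rewrite /h -scalerAl size_scale; last first.
      by rewrite mulf_neq0 ?invr_eq0 ?lead_coef_eq0.
    by rewrite size_monicM ?monicXn // size_polyXn addSn /= subnK.
  have lh : lead_coef h = lead_coef f.
    by rewrite lead_coefM lead_coefZ lead_coefXn mulr1 divfK ?lead_coef_eq0.
  have sf : (0 < size f)%N by rewrite size_poly_gt0.
  rewrite -(prednK sf) ltnS.
  apply/leq_sizeP => j; rewrite leq_eqVlt => /orP[/eqP <-|jf].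
    by rewrite coefB -[h`_ _]/(h`_(size f).-1) -{2}sh -!lead_coefE lh subrr.
  have jf' : (size f <= j)%N by rewrite -(prednK sf).
  by rewrite coefB !nth_default ?subrr ?sh.
- by rewrite rpredB.
exists (u + c *: 'X^(size f - size g)), v; split=> //.
by rewrite mulrDl addrAC -E -/h subrK.
Qed.


(** Descent on the size of a nonzero [q]. The remainder of X^p - x^p = (X - x)^p modulo [q] is
    smaller and vanishes at [x], so it is 0 and q = a (X - x)^k with 0 < k < p. If k = 1, the
    coefficients of [q] put [x] in [F]; if k > 1, the derivative is a smaller nonzero polynomial
    over [F] vanishing at [x]. *)
Lemma pth_root_poly_eq0 F (FS : subfield F) x (q : {poly Omega}) :
  F (x ^+ p) -> ~ F x -> q \is a polyOver (in_subfield FS) ->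
  (size q <= p)%N -> root q x -> q = 0.
Proof.
move=> Fxp Fx; have [n] := ubnP (size q); elim: n q => // n IHn q.
rewrite ltnS => qn Fq qp qx; apply/eqP/negPn/negP => q0.
pose P : {poly Omega} := 'X^p - (x ^+ p)%:P.
have PE : P = ('X - x%:P) ^+ p.
  have pp : [pchar {poly Omega}].-nat p.
    by rewrite pnatE // (pchar_poly Omega p).
  by rewrite exprDn_pchar // exprNn_pchar // -polyC_exp.
have FP : P \is a polyOver (in_subfield FS).
  by rewrite polyOverXnsubC in_subfieldE; apply: mem_set.
have [u [v [Fv E vq]]] := polyOver_division q0 FP Fq.
have v0 : v = 0.
  apply: IHn => //; first exact: leq_trans vq qn.
    exact: leq_trans (ltnW vq) qp.
  have -> : v = P - u * q by rewrite E addrAC subrr add0r.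
  by rewrite rootE !hornerE (rootP qx) mulr0 subr0 subrr.
have : q %| ('X - x%:P) ^+ p by rewrite -PE E v0 addr0 dvdp_mull.
case/dvdp_exp_XsubCP => k _ qk.
have sq : size q = k.+1 by rewrite (eqp_size qk) size_exp_XsubC.
have [[c d] /= /andP[c0 d0] qE] := eqpP _ _ qk.
have {d0 qE} [a a0 qE] : exists2 a, a != 0 & q = a *: ('X - x%:P) ^+ k.
  exists (c^-1 * d); first by rewrite mulf_neq0 ?invr_eq0.
  by rewrite -scalerA -qE scalerA mulVf // scale1r.
have k0 : (0 < k)%N.
  case: k {qk} sq qE => // _ qE.
  by move: qx; rewrite qE expr0 rootE !hornerE (negPf a0).
have k_neq0 : k%:R != 0 :> Omega.
  by rewrite -(dvdn_pcharf charp) gtnNdvd // -sq.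
have [k1|k1] := leqP k 1.
  have kE : k = 1%N by apply/eqP; rewrite eqn_leq k1.
  apply: Fx; have Fa : F a.
    have := polyOverP Fq 1%N.
    rewrite qE kE expr1 coefZ coefB coefX coefC subr0 mulr1 in_subfieldE.
    exact: set_mem.
  have Fax : F (0 - a * x).
    have := polyOverP Fq 0%N.
    rewrite qE kE expr1 coefZ coefB coefX coefC /= mulrBr mulr0 in_subfieldE.
    exact: set_mem.
  have -> : x = (0 - (0 - a * x)) / a by rewrite !sub0r opprK mulrC mulKf.
  by apply: subfield_div => //; apply: subfieldB => //; apply: subfield0.
have qE' : q^`() = (k%:R * a) *: ('X - x%:P) ^+ k.-1.
  by rewrite qE derivZ deriv_exp derivXsubC mul1r -scaler_nat scalerA mulrC.
have : q^`() = 0.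
  apply: IHn.
  - rewrite (leq_trans _ qn) // lt_size_deriv //.
  - exact: polyOver_deriv.
  - exact: leq_trans (ltnW (lt_size_deriv q0)) qp.
  - by rewrite qE' rootE !hornerE subrr expr0n eqn0Ngt -subn1 subn_gt0 k1 mulr0.
move/eqP; rewrite qE' scaler_eq0 mulf_eq0 (negPf k_neq0) (negPf a0) /=.
by rewrite expf_eq0 polyXsubC_eq0 andbF.
Qed.

(** The values q(x) already form a field, because r(x)^p lies in [F] and 1/r(x) = r(x)^(p-1) /
    r(x)^p. Reduction modulo X^p - x^p then brings the degree below p. *)
Lemma adjoin_pth_root F (FS : subfield F) x z :
  F (x ^+ p) -> adjoin F [set x] z ->
  exists q : {poly Omega},
    [/\ q \is a polyOver (in_subfield FS), (size q <= p)%N & z = q.[x]].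
Proof.
move=> Fxp.
pose A := [set z | exists2 q : {poly Omega},
  q \is a polyOver (in_subfield FS) & z = q.[x]].
have A_root q : q \is a polyOver (in_subfield FS) -> F (q.[x] ^+ p).
  move=> Fq; have RS := root_field_subfield 1 FS.
  have : q.[x] \in in_subfield RS.
    apply: rpred_horner; last by apply: mem_set; rewrite /root_field /= expn1.
    apply: (polyOverS _ Fq) => y; rewrite !in_subfieldE => /set_mem Fy.
    by apply: mem_set; apply: subfieldX.
  by move/set_mem; rewrite /root_field /= expn1.
have AS : subfield A.
  apply: subfieldP => [|_ _ [q Fq ->] [r Fr ->]|_ _ [q Fq ->] [r Fr ->]].
  - by exists 1; rewrite ?rpred1 // hornerC.
  - by exists (q - r); rewrite ?rpredB // !hornerE.
  - exists (((r.[x]) ^+ p)^-1 *: (q * r ^+ p.-1)).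
      rewrite polyOverZ //; last by rewrite rpredM ?rpredX.
      by rewrite rpredV in_subfieldE; apply: mem_set; apply: A_root.
    (* If r(x) = 0, both sides vanish, since the inverse of 0 is 0. *)
    rewrite hornerZ hornerM horner_exp; have [->|r0] := eqVneq r.[x] 0.
      by rewrite [0 ^+ p]expr0n gtn_eqF ?prime_gt0 // invr0 mulr0 mul0r.
    have -> : r.[x] ^+ p = r.[x] * r.[x] ^+ p.-1.
      by rewrite -exprS prednK ?prime_gt0.
    by rewrite invfM [RHS]mulrC (mulrC r.[x]^-1) mulrA mulfK ?expf_neq0.
move=> Az; have {Az} [q Fq zE] : A z.
  move: z Az; apply: adjoin_sub => // y.
    move=> Fy; exists y%:P; last by rewrite hornerC.
    by rewrite polyOverC in_subfieldE; apply: mem_set.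
  by move=> /= ->; exists 'X; rewrite ?polyOverX // hornerX.
pose P : {poly Omega} := 'X^p - (x ^+ p)%:P.
have FP : P \is a polyOver (in_subfield FS).
  by rewrite polyOverXnsubC in_subfieldE; apply: mem_set.
have sP : size P = p.+1 by rewrite size_XnsubC ?prime_gt0.
have P0 : P != 0 by rewrite -size_poly_gt0 sP.
have [u [v [Fv E vq]]] := polyOver_division P0 Fq FP.
exists v; split=> //; first by rewrite -ltnS -sP.
by rewrite zE E !hornerE subrr mulr0 add0r.
Qed.

(** Write y = q(x) with q over [F] of degree below p. If [x] were not in F(y), then q - y, a
    polynomial over F(y) that vanishes at [x], would be zero, and [y] would be the constant
    coefficient of q, an element of [F]. *)
Lemma pth_root_exchange F x y : subfield F -> F (x ^+ p) -> F (y ^+ p) ->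
  adjoin F [set x] y -> ~ F y -> adjoin F [set y] x.
Proof.
move=> FS Fxp Fyp /(adjoin_pth_root FS Fxp)[q [Fq qp yE]] Fy.
apply: contrapT => Gx; apply: Fy.
have GS := @adjoin_subfield _ F [set y].
have q_y : q - y%:P = 0.
  apply: (@pth_root_poly_eq0 _ GS x) => //.
  - exact: sub_adjoin_base.
  - apply: rpredB.
      apply: (polyOverS _ Fq) => u; rewrite !in_subfieldE => /set_mem Fu.
      by apply: mem_set; apply: sub_adjoin_base.
    rewrite polyOverC in_subfieldE; apply: mem_set.
    exact: sub_adjoin_gen.
  - rewrite (leq_trans (size_polyD _ _)) // geq_max qp size_polyN.
    by rewrite (leq_trans (size_polyC_leq1 _)) // prime_gt0.
  - by rewrite rootE !hornerE -yE subrr.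
have -> : y = q`_0.
  by move/subr0_eq: q_y => ->; rewrite coefC.
by apply: set_mem; have := polyOverP Fq 0%N.
Qed.


(** * Independent lists and the Steinitz inequality *)

(** A one-sided form of r-independence, suited to induction on the list. When [F] contains the p-th
    powers of the entries, the exchange property makes it equivalent to independence of each entry
    from all the others. *)
Fixpoint free_over F s : Prop :=
  if s is x :: t then ~ F x /\ free_over (adjoin F [set x]) t else True.

Lemma free_over_rcons F s x : subfield F ->
  free_over F (rcons s x) <-> free_over F s /\ ~ adjoin F [set` s] x.
Proof.
elim: s F => [|y s IHs] F FS /=.
  by rewrite adjoin_nil //; split=> [[]|[]].
have := IHs _ (@adjoin_subfield _ F [set y]); rewrite -adjoin_cons => ->.
by split=> [[? []]|[[]]].
Qed.

Lemma free_over_basis F s : subfield F ->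
  exists t, [/\ [set` t] `<=` [set` s], free_over F t &
                [set` s] `<=` adjoin F [set` t]].
Proof.
elim: s F => [|x s IHs] F FS; first by exists [::]; split.
have [Fx|Fx] := pselect (F x).
  have [t [ts ft st]] := IHs F FS; exists t; split=> //.
    by move=> y /ts /= ys; rewrite inE ys orbT.
  move=> y /=; rewrite inE => /orP[/eqP ->|]; last exact: st.
  exact: sub_adjoin_base.
have [t [ts ft st]] := IHs _ (@adjoin_subfield _ F [set x]).
exists (x :: t); split=> //.
  by rewrite !set_cons => z [|/ts]; [left|right].
rewrite adjoin_cons set_cons => y [/= ->|]; last exact: st.
by apply: sub_adjoin_base; apply: sub_adjoin_gen.
Qed.

(** If no free list in [L] generated [L], every free list could be extended, up to length d + 1. *)
Lemma bounded_free_over_basis F L d : subfield F ->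
  (forall s, [set` s] `<=` L -> free_over F s -> (size s <= d)%N) ->
  exists s, [/\ [set` s] `<=` L, free_over F s & L `<=` adjoin F [set` s]].
Proof.
move=> FS bd.
have [//|/forallNP nb] := pselect (exists s,
  [/\ [set` s] `<=` L, free_over F s & L `<=` adjoin F [set` s]]).
have [s [sn sL fs]] : exists s, [/\ size s = d.+1, [set` s] `<=` L
    & free_over F s].
  elim: d.+1 => [|n [s [sn sL fs]]]; first by exists [::].
  have [x Lx Fx] : exists2 x, L x & ~ adjoin F [set` s] x.
    apply: contrapT => H; apply: (nb s); split=> // x Lx.
    by apply: contrapT => Fx; apply: H; exists x.
  exists (rcons s x); rewrite size_rcons sn; split=> //.
    by move=> y /=; rewrite mem_rcons inE => /orP[/eqP ->|/sL].
  exact/free_over_rcons.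
by have := bd s sL fs; rewrite sn ltnn.
Qed.

(** The entry dropped is the first one whose adjunction, after the earlier ones, brings [x] into the
    field; by exchange it is recovered from [x] and those earlier entries. *)
Lemma pth_root_exchange_seq F s x : subfield F ->
  (forall y, y \in s -> F (y ^+ p)) -> F (x ^+ p) -> ~ F x ->
  adjoin F [set` s] x ->
  exists t, [/\ size s = (size t).+1, [set` t] `<=` [set` s] &
    [set` s] `<=` adjoin (adjoin F [set x]) [set` t]].
Proof.
elim: s F => [|y s IHs] F FS Fs Fxp Fx; first by rewrite adjoin_nil.
rewrite adjoin_cons => sx.
have Fyp : F (y ^+ p) by apply: Fs; rewrite inE eqxx.
have [yx|yx] := pselect (adjoin F [set y] x).
  exists s; split=> //; first by rewrite set_cons => z; right.
  move=> z /=; rewrite inE => /orP[/eqP ->|zs]; last exact: sub_adjoin_gen.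
  by apply: sub_adjoin_base; apply: pth_root_exchange.
have [||//|//|t [st ts tE]] := IHs _ (@adjoin_subfield _ F [set y]).
- move=> z zs; apply: sub_adjoin_base; apply: Fs.
  by rewrite inE zs orbT.
- exact: sub_adjoin_base.
exists (y :: t); split; first by rewrite /= st.
  by rewrite !set_cons => z [|/ts]; [left|right].
rewrite [X in X `<=` _]set_cons => z [/= ->|/tE].
  by apply: sub_adjoin_gen; rewrite /= inE eqxx.
rewrite !adjoin_adjoin set_cons; apply: adjoinS => // u.
by move=> [[]|]; rewrite /setU /=; tauto.
Qed.

(** The head of [s] is absorbed into the base field at the cost of one entry of [t]. *)
Lemma steinitz F s t : subfield F -> free_over F s ->
  (forall y, y \in t -> F (y ^+ p)) -> [set` s] `<=` adjoin F [set` t] ->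
  (size s <= size t)%N.
Proof.
elim: s F t => // x s IHs F t FS /= [Fx fs] Ft st.
have tx : adjoin F [set` t] x by apply: st; rewrite /= inE eqxx.
have Fxp : F (x ^+ p).
  (* The elements whose p-th power lies in [F] form a field, which contains [F] and [t], hence
     F(t). *)
  suff : adjoin F [set` t] `<=` root_field p F 1.
    by move/(_ x tx); rewrite /root_field /= expn1.
  apply: adjoin_sub; first exact: root_field_subfield.
    by move=> z Fz; apply: subfieldX.
  by move=> z zt; rewrite /root_field /= expn1; apply: Ft.
have [t' [-> t't tE]] := pth_root_exchange_seq FS Ft Fxp Fx tx.
rewrite ltnS; apply: (IHs _ _ (@adjoin_subfield _ F [set x])) => //.
  by move=> y /t't yt; apply: sub_adjoin_base; apply: Ft.
move=> y ys; have : adjoin F [set` t] y by apply: st; rewrite /= inE ys orbT.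
move: y {ys}; apply: adjoin_sub => //; first exact: adjoin_subfield.
by move=> z Fz; do 2! apply: sub_adjoin_base.
Qed.

(** * Frobenius images, r-bases and monotonicity of di *)

Definition frobenius_image e L := [set x ^+ (p ^ e) | x in L].

Lemma frobenius_image0 L : frobenius_image 0 L = L.
Proof.
apply/seteqP; split=> [_ [x Lx <-]|x Lx]; first by rewrite expr1.
by exists x; rewrite ?expr1.
Qed.

Lemma frobenius_image1 L : frobenius_image 1 L = [set x ^+ p | x in L].
Proof. by []. Qed.

Lemma sub_frobenius_image e L : subfield L -> frobenius_image e L `<=` L.
Proof. by move=> LS _ [x Lx <-]; apply: subfieldX. Qed.

Lemma adjoin_frobenius e F S G z : subfield G ->
  (forall x, F x -> G (x ^+ (p ^ e))) -> (forall x, S x -> G (x ^+ (p ^ e))) ->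
  adjoin F S z -> G (z ^+ (p ^ e)).
Proof.
move=> GS FG SG; apply: (@adjoin_sub _ F S (root_field p G e)) => //.
exact: root_field_subfield.
Qed.

(** Induction on e: the p-th power of L = k(L^{p^e})(S) puts L^p inside k(L^{p^(e+1)})(S), and this
    is substituted into L = k(L^p)(S). *)
Lemma frobenius_generation k L S : subfield k -> S `<=` L ->
  L `<=` adjoin (adjoin k (frobenius_image 1 L)) S ->
  forall e, L `<=` adjoin (adjoin k (frobenius_image e L)) S.
Proof.
move=> kS SL LE; elim=> [|e IHe].
  rewrite frobenius_image0 => x Lx.
  by apply: sub_adjoin_base; apply: sub_adjoin_gen.
set T := adjoin _ _; apply: (subset_trans LE).
have TS : subfield T by apply: adjoin_subfield.
have kT : k `<=` T by move=> x kx; do 2! apply: sub_adjoin_base.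
have ST : S `<=` T by apply: sub_adjoin_gen.
apply: (adjoin_sub TS) => //; apply: (adjoin_sub TS) => // _ [x Lx <-].
apply: (adjoin_frobenius TS _ _ (IHe x Lx)); last first.
  by move=> y Sy; apply: (subfieldX _ TS); apply: ST.
move=> y; apply: (adjoin_frobenius TS).
  by move=> z kz; apply: (subfieldX _ TS); apply: kT.
move=> _ [z Lz <-]; apply: sub_adjoin_base; apply: sub_adjoin_gen.
by exists z => //; rewrite -exprM -expnD addn1.
Qed.

Lemma frobenius_generation_finite_exponent k L S e : subfield k -> S `<=` L ->
  frobenius_image e L `<=` k ->
  L `<=` adjoin (adjoin k (frobenius_image 1 L)) S -> L `<=` adjoin k S.
Proof.
move=> kS SL Lk LE; have := @frobenius_generation _ _ _ kS SL LE e.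
by rewrite (adjoin_id kS Lk).
Qed.

(** For an extension L/k, this bounds the cardinality of an r-basis by [d], whether or not the
    exponent is finite. *)
Definition frobenius_generated k L d :=
  exists s, [/\ (size s <= d)%N, [set` s] `<=` L &
    L `<=` adjoin (adjoin k (frobenius_image 1 L)) [set` s]].

(** Let x be outside L, K = L(x) and G = k(K^p), a subfield of L. A list in L free over G stays free
    when x is appended, so it has fewer than d entries. A maximal such list t gives L = G(t), and G
    = k(L^p)(x^p); so x^p and t, at most d elements, generate L over k(L^p). *)
Lemma frobenius_generated_pth_root k L x d : subfield L -> k `<=` L ->
  L (x ^+ p) -> frobenius_generated k (adjoin L [set x]) d ->
  frobenius_generated k L d.
Proof.
move=> LS kL Lxp [s [sd]].
have [Lx|Lx] := pselect (L x).
  rewrite adjoin_id; last by move=> _ ->.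
    by move=> sL LE; exists s.
  exact: LS.
set K := adjoin L [set x]; set G := adjoin k _ => sK KG.
have KS : subfield K by apply: adjoin_subfield.
have GS : subfield G by apply: adjoin_subfield.
have LK : L `<=` K by apply: sub_adjoin_base.
have Kx : K x by apply: sub_adjoin_gen.
have GL : G `<=` L.
  apply: adjoin_sub => // _ [y Ky <-]; apply: adjoin_frobenius Ky => //.
    by move=> z Lz; apply: subfieldX.
  by move=> _ ->; rewrite expn1.
have Gp y : K y -> G (y ^+ p).
  by move=> Ky; apply: sub_adjoin_gen; exists y; rewrite // expn1.
have bd t : [set` t] `<=` L -> free_over G t -> (size t < d)%N.
  move=> tL ft; rewrite (leq_trans _ sd) // -(size_rcons t x).
  apply: (steinitz GS); last first.
  - move=> y /=; rewrite mem_rcons inE => /orP[/eqP ->|/tL Ly]; apply: KG => //.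
    exact: LK.
  - by move=> y /sK; apply: Gp.
  - apply/free_over_rcons => //; split=> // tx; apply: Lx; move: tx.
    exact: (adjoin_sub LS).
have [t tL ft|t [tL ft Lt]] := @bounded_free_over_basis G L d GS.
  by apply: ltnW; apply: bd.
exists (x ^+ p :: t); split; first exact: bd.
  by rewrite set_cons => y [/= ->|/tL].
rewrite adjoin_cons; apply: subset_trans Lt _; apply: adjoinS => //.
set F := adjoin _ [set x ^+ p].
have FS : subfield F by apply: adjoin_subfield.
apply: (adjoin_sub FS).
  by move=> y ky; do 2! apply: sub_adjoin_base.
move=> _ [y Ky <-]; apply: adjoin_frobenius Ky => //.
  move=> z Lz; apply: sub_adjoin_base; apply: sub_adjoin_gen.
  by exists z.
by move=> _ ->; rewrite expn1; apply: sub_adjoin_gen.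
Qed.

(** The descent goes from L(x) to L(x^p) by one p-th root, then to L by induction applied to x^p. *)
Lemma frobenius_generated_root k L x n d : subfield L -> k `<=` L ->
  L (x ^+ (p ^ n)) -> frobenius_generated k (adjoin L [set x]) d ->
  frobenius_generated k L d.
Proof.
elim: n L x => [|n IHn] L x LS kL Lx gx.
  by rewrite adjoin_id // in gx => _ ->; rewrite -[x]expr1.
have {}Lx : L ((x ^+ p) ^+ (p ^ n)) by rewrite -exprM -expnS.
apply: (IHn L (x ^+ p)) => //.
apply: (@frobenius_generated_pth_root k _ x).
- exact: adjoin_subfield.
- by apply: subset_trans kL _; apply: sub_adjoin_base.
- exact: sub_adjoin_gen.
rewrite adjoin_adjoin; congr (frobenius_generated k _ d): gx.
apply/seteqP; split; first by apply: adjoinS => // y; right.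
apply: adjoin_sub; first exact: adjoin_subfield.
  exact: sub_adjoin_base.
move=> y [->|]; last exact: sub_adjoin_gen.
apply: (@subfieldX _ (adjoin L [set x])); first exact: adjoin_subfield.
exact: sub_adjoin_gen.
Qed.

Lemma frobenius_generated_roots k L s n d : subfield L -> k `<=` L ->
  (forall x, x \in s -> L (x ^+ (p ^ n))) ->
  frobenius_generated k (adjoin L [set` s]) d -> frobenius_generated k L d.
Proof.
elim: s L => [|x s IHs] L LS kL Ls; first by rewrite adjoin_nil.
rewrite adjoin_cons => gs.
apply: (@frobenius_generated_root k L x n) => //.
  by apply: Ls; rewrite inE eqxx.
apply: IHs gs; first exact: adjoin_subfield.
  by apply: subset_trans kL _; apply: sub_adjoin_base.
by move=> y ys; apply: sub_adjoin_base; apply: Ls; rewrite inE ys orbT.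
Qed.

(* Monotonicity of di: L is reached from k(s) by removing p-th roots one at a
   time, which does not increase the size of an r-basis. *)
Lemma sub_finite_generation k L s e : subfield k -> subfield L -> k `<=` L ->
  (forall x, x \in s -> k (x ^+ (p ^ e))) -> L `<=` adjoin k [set` s] ->
  exists2 t, (size t <= size s)%N & L = adjoin k [set` t].
Proof.
move=> kS LS kL ks Ls; have sS := @adjoin_subfield _ k [set` s].
have [] : frobenius_generated k L (size s).
  apply: (@frobenius_generated_roots k L s e) => //.
    by move=> x xs; apply: kL; apply: ks.
  exists s; split=> //; first exact: sub_adjoin_gen.
  apply: adjoin_sub; first exact: adjoin_subfield.
    apply: subset_trans Ls _; apply: adjoinS => //.
    exact: sub_adjoin_base.
  exact: sub_adjoin_gen.
move=> t [ts tL LE]; exists t => //; apply/seteqP; split.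
  apply: (@frobenius_generation_finite_exponent k L [set` t] e) => //.
  move=> _ [x /Ls sx <-]; apply: adjoin_frobenius sx => //.
  by move=> y ky; apply: subfieldX.
exact: adjoin_sub.
Qed.


(* For a purely inseparable extension this says that di(K/k) <= d. *)
Definition di_le k K d :=
  forall s, [set` s] `<=` K ->
  exists2 t, (size t <= d)%N & adjoin k [set` s] = adjoin k [set` t].

Lemma di_leS k L K d : L `<=` K -> di_le k K d -> di_le k L d.
Proof. by move=> LK Kd s sL; apply: Kd; apply: subset_trans LK. Qed.

Lemma pth_power_leq k x e f : subfield k -> (e <= f)%N ->
  k (x ^+ (p ^ e)) -> k (x ^+ (p ^ f)).
Proof.
by move=> kS ef kx; rewrite -(subnKC ef) expnD exprM; apply: subfieldX.
Qed.

(** The exponent is taken positive because the supremum defining di runs over n >= 1. *)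
Lemma common_exponent k K s : subfield k ->
  (forall x, K x -> exists e, k (x ^+ (p ^ e))) -> [set` s] `<=` K ->
  exists2 e, (0 < e)%N & forall x, x \in s -> k (x ^+ (p ^ e)).
Proof.
move=> kS kK; elim: s => [|x s IHs] sK; first by exists 1%N.
have [y /= ys|e e0 se] := IHs; first by apply: sK; rewrite /= inE ys orbT.
have [|f xf] := kK x; first by apply: sK; rewrite /= inE eqxx.
exists (maxn e f); first by rewrite leq_max e0.
move=> y; rewrite inE => /orP[/eqP ->|/se ye].
  by apply: pth_power_leq xf => //; apply: leq_maxr.
by apply: pth_power_leq ye => //; apply: leq_maxl.
Qed.

(** * Relatively perfect extensions and strict growth of di *)

Definition relatively_perfect k L := L `<=` adjoin k (frobenius_image 1 L).

(** This is [frobenius_generation] for the empty set of generators. *)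
Lemma relatively_perfect_frobenius k L : subfield k -> relatively_perfect k L ->
  forall e, L `<=` adjoin k (frobenius_image e L).
Proof.
move=> kS Lp e; have S0 F : adjoin (adjoin k F) set0 = adjoin k F.
  by apply: adjoin_id => //; apply: adjoin_subfield.
rewrite -S0; apply: frobenius_generation => //.
by rewrite S0.
Qed.

Lemma relatively_perfect_trans k L M : L `<=` M ->
  relatively_perfect k L -> relatively_perfect L M -> relatively_perfect k M.
Proof.
move=> LM Lp Mp x /Mp; move: x; apply: adjoin_sub.
- exact: adjoin_subfield.
- apply: subset_trans Lp _; apply: adjoinS => // _ [x Lx <-].
  by exists x => //; apply: LM.
- exact: sub_adjoin_gen.
Qed.

(* The descending chain L(N^{p^e}) is stationary once p^e kills the exponents
   over k of a finite r-basis of N/k. *)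
Lemma frobenius_image_stationary k L N d : subfield k -> subfield N ->
  k `<=` N -> k `<=` L -> (forall x, N x -> exists e, k (x ^+ (p ^ e))) ->
  di_le k N d ->
  exists e, relatively_perfect L (adjoin L (frobenius_image e N)).
Proof.
move=> kS NS kN kL Nk Nd; pose G := adjoin k (frobenius_image 1 N).
have GS : subfield G by apply: adjoin_subfield.
(* A finite r-basis of N/k exists: a free list in N lies in some k(t) with at most d entries in t,
   and [steinitz] over G = k(N^p) bounds its length. *)
have [s sN fs|s [sN _ Ns]] := @bounded_free_over_basis G N d GS.
  have [t td st] := Nd s sN; apply: leq_trans td.
  have tN : [set` t] `<=` N.
    apply: (@subset_trans _ (adjoin k [set` t])); first exact: sub_adjoin_gen.
    by rewrite -st; apply: adjoin_sub.
  apply: (steinitz GS) => //.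
    by move=> y /tN Ny; apply: sub_adjoin_gen; exists y; rewrite // expn1.
  apply: (@subset_trans _ (adjoin k [set` s])); first exact: sub_adjoin_gen.
  by rewrite st; apply: adjoinS => //; apply: sub_adjoin_base.
have [e _ se] := common_exponent kS Nk sN; exists e.
apply: adjoin_sub; first exact: adjoin_subfield.
  exact: sub_adjoin_base.
set T := adjoin _ _; have TS : subfield T by apply: adjoin_subfield.
have kT : k `<=` T by apply: subset_trans kL _; apply: sub_adjoin_base.
(* The power p^e of N = k(N^p)(s) sends s into k, and the elements of N^{p^(e+1)} are p-th powers of
   elements of N^{p^e}. *)
move=> _ [x /Ns Nx <-]; apply: (adjoin_frobenius TS _ _ Nx); last first.
  by move=> y /se ky; apply: kT.
move=> y; apply: (adjoin_frobenius TS).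
  by move=> z kz; apply: (subfieldX _ TS); apply: kT.
move=> _ [z Nz <-]; apply: sub_adjoin_gen; exists (z ^+ (p ^ e)).
  by apply: sub_adjoin_gen; exists z.
by rewrite -!exprM mulnC.
Qed.

Lemma sub_image_map (f : Omega -> Omega) L s : [set` s] `<=` f @` L ->
  exists2 t, [set` t] `<=` L & s = map f t.
Proof.
elim: s => [|x s IHs] sL; first by exists [::].
have [y /= ys|t tL ->] := IHs; first by apply: sL; rewrite /= inE ys orbT.
have [|y Ly <-] := sL x; first by rewrite /= inE eqxx.
by exists (y :: t) => //; rewrite set_cons => z [/= ->|/tL].
Qed.

(* Let x in M \ L have exponent c over k. Any finite set of elements of L lies
   in k(t^{p^c}) for a finite t in L. As x is not in k(t), it can be completed
   by elements of t to an r-basis of k(t, x), which has at most d elements, and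
   x disappears on raising to the power p^c. *)
Lemma relatively_perfect_di_lt k L M d : subfield k -> subfield L ->
  k `<=` L -> L `<` M -> (forall x, M x -> exists e, k (x ^+ (p ^ e))) ->
  relatively_perfect k L -> di_le k M d -> (0 < d)%N /\ di_le k L d.-1.
Proof.
move=> kS LS kL [LM ML] Mk Lp Md.
have [x Mx Lx] : exists2 x, M x & ~ L x.
  apply: contrapT => H; apply: ML => x Mx; apply: contrapT => Lx.
  by apply: H; exists x.
have [c kx] := Mk x Mx.
(* The strict bound gives both conclusions; the empty list yields 0 < d. *)
suff lt_d s : [set` s] `<=` L ->
    exists2 t, (size t < d)%N & adjoin k [set` s] = adjoin k [set` t].
  have d0 : (0 < d)%N.
    by have [//|t td _] := lt_d [::]; apply: leq_ltn_trans td.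
  by split=> // s /lt_d [t]; rewrite -{1}(prednK d0) ltnS; exists t.
move=> sL.
have [t0 t0L st0] := adjoin_seq_finitary
  (subset_trans sL (@relatively_perfect_frobenius _ _ kS Lp c)).
have [t tL t0E] := sub_image_map t0L.
pose W := adjoin k [set` x :: t].
have WS : subfield W by apply: adjoin_subfield.
have kW : k `<=` W by apply: sub_adjoin_base.
have xtM : [set` x :: t] `<=` M by rewrite set_cons => y [/= ->|/tL /LM].
have [b bd WE] := Md _ xtM; rewrite -/W in WE.
have xtW : [set` x :: t] `<=` W by apply: sub_adjoin_gen.
have Wx : W x by apply: xtW; rewrite /= inE eqxx.
have tW : [set` t] `<=` W by move=> y yt; apply: xtW; rewrite /= inE yt orbT.
have bW : [set` b] `<=` W by rewrite WE; apply: sub_adjoin_gen.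
have [e _ We] := common_exponent kS Mk xtM.
have {}We : frobenius_image e W `<=` k.
  move=> _ [y Wy <-]; apply: adjoin_frobenius Wy => // z kz.
  exact: subfieldX.
pose G := adjoin k (frobenius_image 1 W).
have GS : subfield G by apply: adjoin_subfield.
have kG : k `<=` G by apply: sub_adjoin_base.
(* Otherwise t would generate W over k(W^p), hence over k because W/k has finite exponent, and x
   would lie in k(t), inside L. *)
have Gx : ~ adjoin G [set` t] x.
  move=> tx; apply: Lx.
  have : W `<=` adjoin k [set` t].
    apply: (frobenius_generation_finite_exponent kS tW We).
    apply: adjoin_sub; first exact: adjoin_subfield.
      by apply: subset_trans kG _; apply: sub_adjoin_base.
    by rewrite set_cons => y [/= ->|] //; apply: sub_adjoin_gen.
  by move/(_ x Wx); apply: adjoin_sub.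
have [u [ut fu tu]] := free_over_basis t GS.
have Wux : W `<=` adjoin k [set` rcons u x].
  apply: (frobenius_generation_finite_exponent kS _ We).
    by move=> y /=; rewrite mem_rcons inE => /orP[/eqP ->|/ut/tW].
  apply: adjoin_sub; first exact: adjoin_subfield.
    by apply: subset_trans kG _; apply: sub_adjoin_base.
  rewrite set_cons => y [/= ->|/tu].
    by apply: sub_adjoin_gen; rewrite /= mem_rcons inE eqxx.
  move: y; apply: adjoinS => // y /= yu.
  by rewrite mem_rcons inE yu orbT.
have ud : (size u < d)%N.
  rewrite (leq_trans _ bd) // -(size_rcons u x).
  apply: (steinitz GS).
  - apply/free_over_rcons => //; split=> // ux; apply: Gx; move: ux.
    exact: adjoinS.
  - by move=> y /bW Wy; apply: sub_adjoin_gen; exists y; rewrite // expn1.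
  - apply: (@subset_trans _ W).
      by move=> y /=; rewrite mem_rcons inE => /orP[/eqP ->|/ut/tW].
    by rewrite WE; apply: adjoinS.
pose v := [seq y ^+ (p ^ c) | y <- u].
have sv : [set` s] `<=` adjoin k [set` v].
  apply: subset_trans st0 _; have vS := @adjoin_subfield _ k [set` v].
  apply: (adjoin_sub vS); first exact: sub_adjoin_base.
  rewrite t0E => _ /mapP[y /tW /Wux uy ->].
  apply: (adjoin_frobenius vS _ _ uy) => z.
    by move=> kz; apply: sub_adjoin_base; apply: subfieldX.
  rewrite /= mem_rcons inE => /orP[/eqP ->|zu].
    exact: sub_adjoin_base.
  by apply: sub_adjoin_gen; apply: map_f.
have vL : [set` v] `<=` L.
  by move=> _ /mapP[y /ut /tL Ly ->]; apply: subfieldX.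
have [f _ vf] := common_exponent kS Mk (subset_trans vL LM).
(* Now k(s) is a subextension of k(v), so by monotonicity of di it needs no more generators than v
   has entries, fewer than d. *)
have [|||r rv rE] := @sub_finite_generation k (adjoin k [set` s]) v f kS _ _ vf.
- exact: adjoin_subfield.
- exact: sub_adjoin_base.
- by apply: adjoin_sub => //; [apply: adjoin_subfield|apply: sub_adjoin_base].
by exists r => //; apply: leq_ltn_trans ud; rewrite size_map in rv.
Qed.

(** A finite list s lies in some level k^{p^{-e}} of K, an extension of k of finite exponent and so
    generated by its r-basis of at most d elements. Monotonicity of di passes this bound to k(s). *)
Lemma di_le_of_q_finite k K d : subfield k -> subfield K -> k `<=` K ->
  (forall x, K x -> exists e, k (x ^+ (p ^ e))) -> is_di p k K d ->
  di_le k K d.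
Proof.
move=> kS KS kK Kk [Kd _] s sK.
have [e e0 se] := common_exponent kS Kk sK.
have [m [B [BK KE _] Bm] md] := Kd e e0.
set Ke := root_field p k e `&` K in BK KE.
have KeS : subfield Ke by rewrite KE; apply: adjoin_subfield.
have [b BE bm] : exists2 b : seq Omega, B = [set` b] & size b = m.
  have /finite_fsetP[X XE] : finite_set B by apply/finite_setP; exists m.
  by exists (finmap.enum_fset X) => //; apply/card_eq_fsetP; rewrite -XE.
rewrite {}BE in BK KE.
have kKe : k `<=` Ke.
  by move=> x kx; split; [apply: subfieldX | apply: kK].
have Keb : Ke `<=` adjoin k [set` b].
  apply: (@frobenius_generation_finite_exponent k Ke [set` b] e) => //.
    by move=> _ [x [kx _] <-].
  by rewrite frobenius_image1 -KE.
have be x : x \in b -> k (x ^+ (p ^ e)) by case/BK.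
have [|||t tb ->] := @sub_finite_generation k (adjoin k [set` s]) b e kS _ _ be.
- exact: adjoin_subfield.
- exact: sub_adjoin_base.
- apply: subset_trans Keb; apply: adjoin_sub => // x xs.
  by split; [apply: se | apply: sK].
by exists t => //; rewrite (leq_trans tb) // bm.
Qed.

(** * Chains of w_0-generated extensions *)

Definition w0_chain L M :=
  exists (n : nat) (F : nat -> set Omega),
    [/\ F 0%N = L, F n = M
      & forall i : nat, (i < n)%N ->
          extension (F i) (F i.+1) /\ w0_generated p (F i) (F i.+1)].

Lemma w0_chain_refl L : w0_chain L L.
Proof. by exists 0%N, (fun=> L). Qed.

Lemma w0_chain1 L M : extension L M -> w0_generated p L M -> w0_chain L M.
Proof.
move=> LM w; exists 1%N, (fun i => if i is 0%N then L else M); split=> // i.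
by rewrite ltnS leqn0 => /eqP ->.
Qed.

Lemma w0_chain_trans L M N : w0_chain L M -> w0_chain M N -> w0_chain L N.
Proof.
move=> [m [F [F0 Fm Fw]]] [n [H [H0 Hn Hw]]].
exists (m + n)%N, (fun i => if (i < m)%N then F i else H (i - m)%N).
split=> [||i imn].
- by case: posnP => [m0|//]; rewrite H0 -Fm m0.
- by rewrite ltnNge leq_addr addKn.
- have [im|mi] := ltnP i m; last first.
    rewrite ltnNge leqW //= subSn //; apply: Hw.
    by rewrite ltn_subLR.
  have [_|mi] := ltnP i.+1 m; first exact: Fw.
  (* At the junction the first chain ends in F m, which is M = H 0. *)
  have mE : m = i.+1 by apply/eqP; rewrite eqn_leq mi.
  by rewrite mE subnn H0 -Fm mE; apply: Fw.
Qed.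

(* The bound a <= di(L/k) is raised, or the bound di(M/k) <= b lowered, each
   time a field is inserted between L and M. *)
Lemma relatively_perfect_w0_chain k n L M a b : subfield k -> subfield L ->
  subfield M -> k `<=` L -> L `<=` M ->
  (forall x, M x -> exists e, k (x ^+ (p ^ e))) ->
  relatively_perfect k L -> relatively_perfect k M ->
  (forall d, di_le k L d -> (a <= d)%N) -> di_le k M b -> (b <= a + n)%N ->
  w0_chain L M.
Proof.
move=> kS; elim: n L M a b => [|n IHn] L M a b LS MS kL LM Mk Lp Mp La Mb ab.
all: have [<-|LneM] := pselect (L = M); first exact: w0_chain_refl.
all: have ltLM : L `<` M by split=> // ML; apply: LneM; apply/seteqP.
all: have [b0 Lb] := relatively_perfect_di_lt kS LS kL ltLM Mk Lp Mb.
  (* For n = 0, a proper inclusion would give a <= b - 1, against b <= a. *)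
  by have := La _ Lb; rewrite -ltnS prednK // ltnNge -[a]addn0 ab.
have [w|] := pselect (w0_generated p L M).
  by apply: w0_chain1 => //; split.
move=> /contrapT[N [[_ NS LN] [NM MN] Ninf]].
have kN : k `<=` N by apply: subset_trans LN.
have Nk x : N x -> exists e, k (x ^+ (p ^ e)) by move/NM/Mk.
have Nb : di_le k N b by apply: di_leS Mb.
have [e Pp'] := frobenius_image_stationary kS NS kN kL Nk Nb.
set P := adjoin L _ in Pp'.
have PS : subfield P by apply: adjoin_subfield.
have LP : L `<=` P by apply: sub_adjoin_base.
have PN : P `<=` N by apply: adjoin_sub => //; apply: sub_frobenius_image.
have PM : P `<=` M by apply: subset_trans NM.
have kP : k `<=` P by apply: subset_trans LP.
have Pp : relatively_perfect k P by apply: relatively_perfect_trans Pp'.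
have Pk x : P x -> exists e, k (x ^+ (p ^ e)) by move/PM/Mk.
have ltPM : P `<` M by split=> // MP; apply: MN; apply: subset_trans PN.
(* If P were L, then N^{p^e} would lie in L and N/L would have bounded exponent. *)
have ltLP : L `<` P.
  split=> // PL; apply: Ninf; exists e; apply: subset_trans PL.
  exact: sub_adjoin_gen.
have [_ Pb] := relatively_perfect_di_lt kS PS kP ltPM Mk Pp Mb.
apply: (@w0_chain_trans _ P).
  apply: (IHn L P a b.-1) => //.
  by rewrite -ltnS prednK // -addnS.
apply: (IHn P M a.+1 b) => //; last by rewrite addSnnS.
move=> d Pd; have [d0 Ld] := relatively_perfect_di_lt kS LS kL ltLP Pk Lp Pd.
by rewrite -(prednK d0) ltnS; apply: La.
Qed.

End PurelyInseparable.

Theorem proposition8p4 (p : nat) (Omega : closedFieldType)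
    (charp : p \in [pchar Omega]) (k K : set Omega)
    (Omega_k : algebraic_closure_of k)
    (K_k : purely_inseparable_ext p k K)
    (qfin : q_finite p k K) :
  exists (n : nat) (F : nat -> set Omega),
    [/\ F 0%N = k,
        F n = K
      & forall i : nat, (i < n)%N ->
          extension (F i) (F i.+1) /\ w0_generated p (F i) (F i.+1)].
Proof.
have [[kS KS kK] Kk] := K_k.
have [d /(di_le_of_q_finite charp kS KS kK Kk) Kd] := qfin.
have [e Mp] :=
  frobenius_image_stationary charp kS KS kK (@subset_refl _ k) Kk Kd.
set M := adjoin k _ in Mp.
have MS : subfield M by apply: adjoin_subfield.
have MK : M `<=` K by apply: adjoin_sub => //; apply: sub_frobenius_image.
have kM : k `<=` M by apply: sub_adjoin_base.
apply: (@w0_chain_trans _ _ _ M).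
  (* With the lower bound 0 for di(k/k) and the upper bound d for di(M/k), refinements nest to depth
     at most d. *)
  apply: (@relatively_perfect_w0_chain _ _ charp k d k M 0 d) => //.
  - by move=> x /MK /Kk.
  - exact: sub_adjoin_base.
  - exact: di_leS Kd.
apply: w0_chain1 => // -[L [_ [LK _] Linf]]; apply: Linf; exists e.
by move=> _ [x /LK Kx <-]; apply: sub_adjoin_gen; exists x.
Qed.
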